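(* Let $M=(M_n)_{n\in\mathbb{N}}$ be an increasing sequence of real numbers with $M_0=1$. Let $p>1$ be an integer and let $I$ be the interval $[0,1]$ if $p$ is even and $[-1,1]$ if $p$ is odd, so that the power substitution $x=\xi^p$ is a bijection of $I$ onto itself. Let $f:I\to\mathbb{R}$ be a smooth function. If the function $$F(\xi):=f(\xi^{p}),\qquad \xi\in I,$$ belongs to $\mathcal{Q}(I,M)$, then $f\in\mathcal{Q}(I,M^{(p)})$, where the sequence $M^{(p)}$ is defined by $M^{(p)}_n:=M_{pn}$ for $n\in\mathbb{N}$. Equivalently, in terms of the sequence $M'_n:=n!\,M_n$, the function $f$ belongs to the class determined by the sequence $M'^{(p)}_n:=\frac{1}{n^{(p-1)n}}\,M'_{pn}$, $n\in\mathbb{N}$, i.e. there are constants $C,R>0$ such that $|f^{(n)}(x)|\le C\,R^n\,M'^{(p)}_n$ for all $n\in\mathbb{N}$ and $x\in I$.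
   Context: Here $\mathbb{N}=\{0,1,2,\dots\}$, ''increasing'' is meant in the sense $M_n\le M_{n+1}$, and $0^0:=1$. For an interval $I\subset\mathbb{R}$ and a sequence $N=(N_n)_{n\in\mathbb{N}}$ of positive reals, $\mathcal{Q}(I,N)$ denotes the class of smooth functions $g:I\to\mathbb{R}$ (with one-sided derivatives at endpoints belonging to $I$) for which there exist constants $C,R>0$ such that $|g^{(n)}(x)|\le C\,R^{n}\,n!\,N_n$ for all $n\in\mathbb{N}$ and all $x\in I$. *)

(* Defs.v *)
From HB Require Import structures.
From mathcomp Require Import all_boot all_order all_algebra.
From mathcomp Require Import all_classical all_reals all_analysis.

Set Implicit Arguments.
Unset Strict Implicit.
Unset Printing Implicit Defensive.

Import Order.TTheory GRing.Theory Num.Theory.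
Import numFieldNormedType.Exports.

Local Open Scope classical_set_scope.
Local Open Scope ring_scope.

(* Functions I -> R are represented by total functions R -> R; everything below
   only depends on their values on I. *)

(* The difference quotient is restricted to points y in I, y != x: this is the
   ordinary derivative at interior points of I and the one-sided derivative at
   endpoints belonging to I. *)
Definition derivable_in (R : realType) (I : interval R) (f : R -> R) (x : R) : Prop :=
  cvg ((f y - f x) / (y - x) @[y --> within [set` I] x^']).

Definition derive_in (R : realType) (I : interval R) (f : R -> R) (x : R) : R :=
  lim ((f y - f x) / (y - x) @[y --> within [set` I] x^']).

Definition deriven_in (R : realType) (I : interval R) (n : nat) (f : R -> R) : R -> R :=
  iter n (derive_in I) f.

Definition smooth_in (R : realType) (I : interval R) (f : R -> R) : Prop :=
  forall (n : nat) (x : R), x \in I -> derivable_in I (deriven_in I n f) x.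

Definition deriv_bounded (R : realType) (I : interval R) (L : nat -> R) (f : R -> R) : Prop :=
  exists C r : R, [/\ 0 < C, 0 < r &
    forall (n : nat) (x : R), x \in I ->
      `|deriven_in I n f x| <= C * r ^+ n * L n].

Definition weighted (R : realType) (N : nat -> R) (n : nat) : R := (n`!)%:R * N n.

Definition ultradiff (R : realType) (I : interval R) (N : nat -> R) (g : R -> R) : Prop :=
  smooth_in I g /\ deriv_bounded I (weighted N) g.

Definition power_interval (R : realType) (p : nat) : interval R :=
  if odd p then `[-1, 1] else `[0, 1].

Definition dilate (R : realType) (p : nat) (M : nat -> R) (n : nat) : R := M (p * n)%N.

(* For n = 0 the denominator is 0 ^+ 0 = 1. *)
Definition dilate_weight (R : realType) (p : nat) (L : nat -> R) (n : nat) : R :=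
  (n%:R ^+ ((p - 1) * n))^-1 * L (p * n)%N.

(* Main.v *)
(* Fix n, put N = p n, let T be the Taylor polynomial of f at 0 of degree < n and
   set h = f - T, G(xi) = h(xi^p). Then G vanishes to order N at 0 and
   G^(N) = F^(N), so integrating N - k times from 0 gives
     |G^(k)(xi)| <= C r^N M_N N!/(N-k)! |xi|^(N-k)   for k <= N.
   Applying the Euler operator xi d/dxi repeatedly to G(xi) = h(xi^p) yields
     xi^(p i) h^(i)(xi^p) = sum_(k <= i) c_(i,k) xi^k G^(k)(xi)
   with sum_k |c_(n,k)| N^k <= n (n+1) ... (2n-1) <= 4^n n!. For i = n all powers
   of xi cancel, which bounds f^(n) = h^(n) off 0, and at 0 by continuity. *)

Require Import Defs.
From HB Require Import structures.
From mathcomp Require Import all_boot all_order all_algebra.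
From mathcomp Require Import all_classical all_reals all_analysis.
From mathcomp Require Import ring lra zify.

Set Implicit Arguments.
Unset Strict Implicit.
Unset Printing Implicit Defensive.

Import Order.TTheory GRing.Theory Num.Theory.
Import numFieldNormedType.Exports.

Local Open Scope classical_set_scope.
Local Open Scope ring_scope.

(** * Derivatives relative to an interval *)

Section Calculus.
Variable R : realType.
Implicit Types (I J : interval R) (f g : R -> R) (x y l : R) (p : {poly R}).

(* Caratheodory's form of the derivative, for which no quotient appears. *)
Definition has_deriv_in I f x l : Prop := exists q : R -> R,
  [/\ forall y, y \in I -> f y - f x = q y * (y - x),
      q y @[y --> within [set` I] (nbhs x)] --> q x & q x = l].

Lemma has_deriv_inE I f x l : x \in I ->
  has_deriv_in I f x l <->
  ((f y - f x) / (y - x) @[y --> within [set` I] x^'] --> l).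
Proof.
move=> xI; split=> [[q [fq qx <-]]|fl].
- move=> A /qx; rewrite /nbhs /= /within /= => nA.
  near=> y => yI.
  have yx : y != x by near: y; exact: nbhs_dnbhs_neq.
  rewrite /= fq // mulfK ?subr_eq0 //.
  suff: [set` I] y -> A (q y) by apply.
  by near: y; apply: cvg_within; exact: nA.
- exists (fun y => if y == x then l else (f y - f x) / (y - x)).
  rewrite eqxx; split=> // [y yI|A].
    by case: eqVneq => [->|yx]; rewrite ?subrr ?mulr0 // divfK // subr_eq0.
  move=> lA; have := fl _ lA.
  rewrite /nbhs /= /within /= !near_withinE => nA.
  near=> y => yI /=; case: eqVneq => [_|yx]; first exact: nbhs_singleton.
  suff: y != x -> [set` I] y -> A ((f y - f x) / (y - x)) by apply.
  by near: y; exact: nA.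
Unshelve. all: by end_near. Qed.

Lemma mem_itv_convex I x z (t : R) : x \in I -> z \in I -> 0 <= t <= 1 ->
  x + t * (z - x) \in I.
Proof.
move=> xI zI /andP[t0 t1].
have [xz|zx] := leP x z.
  by apply: (interval_is_interval xI zI); apply/andP; split; nra.
by apply: (interval_is_interval zI xI); apply/andP; split; nra.
Qed.

(** The segment from x to z stays in I and has points arbitrarily close to x, so limits along I at x
    are unique. *)
Lemma within_dnbhs_proper I x z : x \in I -> z \in I -> x != z ->
  ProperFilter (within [set` I] x^').
Proof.
move=> xI zI xz; apply: Build_ProperFilter_ex => P; rewrite /within /= => nP.
have := nP; rewrite /dnbhs /within /= => -[e /= e0 eP].
have zx : 0 < `|z - x| by rewrite normr_gt0 subr_eq0 eq_sym.
pose t := Num.min 1 (e / (2 * `|z - x|)).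
have t0 : 0 < t by rewrite lt_min ltr01 divr_gt0 // mulr_gt0.
exists (x + t * (z - x)); apply: eP => /=.
- rewrite opprD addNKr normrN normrM (gtr0_norm t0).
  apply: (@le_lt_trans _ _ (e / 2)); last by lra.
  rewrite -ler_pdivlMr // ge_min; apply/orP; right.
  by rewrite invfM mulrA.
- rewrite -subr_eq0 addrC addKr; apply: mulf_neq0; first exact: lt0r_neq0.
  by rewrite subr_eq0 eq_sym.
- by apply: mem_itv_convex => //; rewrite ltW //= ge_min lexx.
Qed.

Lemma has_deriv_in_lim I f x z l : x \in I -> z \in I -> x != z ->
  has_deriv_in I f x l -> derive_in I f x = l.
Proof.
move=> xI zI xz /(has_deriv_inE _ _ xI) fl.
have PF := within_dnbhs_proper xI zI xz.
exact: cvg_lim.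
Qed.

Lemma derivable_in_has_deriv I f x : x \in I ->
  derivable_in I f x -> has_deriv_in I f x (derive_in I f x).
Proof. by move=> xI fx; apply/has_deriv_inE. Qed.

Lemma has_deriv_in_cvg I f x l : has_deriv_in I f x l ->
  f y @[y --> within [set` I] (nbhs x)] --> f x.
Proof.
move=> [q [fq qx _]].
have idx : y @[y --> within [set` I] (nbhs x)] --> x by exact: cvg_within.
have : f x + q y * (y - x) @[y --> within [set` I] (nbhs x)] -->
    f x + q x * (x - x).
  by apply: cvgD; [exact: cvg_cst|apply: cvgM => //; apply: cvgB => //; exact: cvg_cst].
rewrite subrr mulr0 addr0; apply: cvg_trans; apply: near_eq_cvg.
by rewrite near_withinE; near=> y => yI; rewrite -fq // addrC subrK.
Unshelve. all: by end_near. Qed.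

Lemma eq_has_deriv_in I f g x l : x \in I -> {in I, f =1 g} ->
  has_deriv_in I f x l -> has_deriv_in I g x l.
Proof.
by move=> xI fg [q [fq qx ql]]; exists q; split=> // y yI; rewrite -!fg ?fq.
Qed.

Lemma has_deriv_in_cst I x (c : R) : has_deriv_in I (cst c) x 0.
Proof.
by exists (cst 0); split=> // [y _|]; [rewrite subrr mul0r|exact: cvg_cst].
Qed.

Lemma has_deriv_in_id I x : has_deriv_in I id x 1.
Proof.
by exists (cst 1); split=> // [y _|]; [rewrite mul1r|exact: cvg_cst].
Qed.

Lemma has_deriv_inD I f g x (a b : R) : has_deriv_in I f x a ->
  has_deriv_in I g x b -> has_deriv_in I (fun y => f y + g y) x (a + b).
Proof.
move=> [q [fq qx <-]] [s [gs sx <-]]; exists (fun y => q y + s y).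
split=> // [y yI|]; last exact: cvgD.
by rewrite mulrDl -fq // -gs //; ring.
Qed.

Lemma has_deriv_inM I f g x (a b : R) : has_deriv_in I f x a ->
  has_deriv_in I g x b ->
  has_deriv_in I (fun y => f y * g y) x (a * g x + f x * b).
Proof.
move=> fa gb; have gx := has_deriv_in_cvg gb.
move: fa gb => [q [fq qx <-]] [s [gs sx <-]].
exists (fun y => q y * g y + f x * s y); split=> // [y yI|].
  have -> : f y * g y - f x * g x = (f y - f x) * g y + f x * (g y - g x) by ring.
  by rewrite fq // gs //; ring.
by apply: cvgD; apply: cvgM => //; exact: cvg_cst.
Qed.

Lemma has_deriv_inZ I f x (c a : R) : has_deriv_in I f x a ->
  has_deriv_in I (fun y => c * f y) x (c * a).
Proof.
move=> fa; have := has_deriv_inM (has_deriv_in_cst I x c) fa.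
by rewrite mul0r add0r.
Qed.

Lemma has_deriv_in_sum I (F : nat -> R -> R) (dF : nat -> R) n x :
  (forall k, (k < n)%N -> has_deriv_in I (F k) x (dF k)) ->
  has_deriv_in I (fun y => \sum_(k < n) F k y) x (\sum_(k < n) dF k).
Proof.
elim: n => [|n IHn] FdF.
  rewrite big_ord0; have -> : (fun y => \sum_(k < 0) F k y) = cst 0.
    by apply/funext => y; rewrite big_ord0.
  exact: has_deriv_in_cst.
have -> : (fun y => \sum_(k < n.+1) F k y) =
    (fun y => \sum_(k < n) F k y + F n y).
  by apply/funext => y; rewrite big_ord_recr.
rewrite big_ord_recr /=; apply: has_deriv_inD; last exact: FdF.
by apply: IHn => k kn; apply: FdF; rewrite ltnS ltnW.
Qed.

(** The product [q (g y) * s y] of the two Caratheodory quotients serves, also at points where g y =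
    g x. *)
Lemma has_deriv_in_comp I J f g x (a b : R) : {homo g : y / y \in J >-> y \in I} ->
  has_deriv_in J g x a -> has_deriv_in I f (g x) b ->
  has_deriv_in J (f \o g) x (b * a).
Proof.
move=> gJI ga [q [fq qx <-]]; have gx := has_deriv_in_cvg ga.
move: ga => [s [gs sx <-]]; exists (fun y => q (g y) * s y); split=> // [y yJ|].
  by rewrite /= fq ?gJI // gs // mulrA.
apply: cvgM => // A /qx; rewrite /nbhs /= /within /= => nA.
have := gx _ nA; rewrite /nbhs /= /within /= => nJ.
near=> y => yJ; have yI := gJI _ yJ.
suff: [set` J] y -> [set` I] (g y) -> A (q (g y)) by apply.
by near: y.
Unshelve. all: by end_near. Qed.

Lemma has_deriv_in_horner I p x : has_deriv_in I (horner p) x p^`().[x].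
Proof.
elim/poly_ind: p => [|p c IHp].
  rewrite deriv0 horner0; have -> : horner (0 : {poly R}) = cst 0.
    by apply/funext => y; rewrite horner0.
  exact: has_deriv_in_cst.
have -> : horner (p * 'X + c%:P) = (fun y => p.[y] * y + c).
  by apply/funext => y; rewrite hornerMXaddC.
rewrite derivD derivM derivX derivC addr0 mulr1 hornerD hornerMX.
have := has_deriv_inD (has_deriv_inM IHp (has_deriv_in_id I x)) (has_deriv_in_cst I x c).
by rewrite addr0 mulr1.
Qed.

Lemma has_deriv_in_exp I n x : has_deriv_in I (fun y => y ^+ n) x (n%:R * x ^+ n.-1).
Proof.
have -> : (fun y => y ^+ n) = horner 'X^n by apply/funext => y; rewrite hornerXn.
have := has_deriv_in_horner I 'X^n x.
by rewrite derivXn hornerMn hornerXn mulr_natl.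
Qed.

(** * Monotonicity and growth estimates *)

Lemma has_deriv_in_is_derive (a b x l : R) f : x \in `]a, b[ ->
  has_deriv_in `[a, b] f x l -> is_derive x 1 f l.
Proof.
move=> xab [q [fq qx ql]]; have xab' := subset_itv_oo_cc xab.
apply/is_derive1_caratheodory.
(* Off [a, b] nothing is known of q, so the plain quotient fills in; x is interior, hence the limit
   at x only sees q. *)
pose g y := if y \in `[a, b] then q y else (f y - f x) / (y - x).
have gx : g x = q x by rewrite /g xab'.
exists g; rewrite gx; split=> // [y|].
  rewrite /g; case: ifPn => [|yab]; first exact: fq.
  by rewrite divfK // subr_eq0; apply: contraNneq yab => ->.
have abx : [set` `[a, b]]° x by rewrite interior_itv_bnd.
have : g y @[y --> within [set` `[a, b]] (nbhs x)] --> q x.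
  apply: (cvg_trans _ qx); apply: near_eq_cvg.
  by rewrite near_withinE; near=> y => yab; rewrite /g ifT.
by rewrite (within_interior abx) -gx.
Unshelve. all: by end_near. Qed.

Lemma has_deriv_in_nincr (a b : R) f df : a <= b ->
  (forall t, t \in `[a, b] -> has_deriv_in `[a, b] f t (df t)) ->
  (forall t, t \in `[a, b] -> df t <= 0) -> f b <= f a.
Proof.
move=> ab fdf df0.
have fd t : t \in `]a, b[ -> is_derive t 1 f (df t).
  by move=> tab; apply: has_deriv_in_is_derive tab (fdf _ (subset_itv_oo_cc tab)).
apply: (@ler0_derive1_nincr _ f a b) => //.
- by move=> t /fd [].
- by move=> t tab; rewrite derive1E; have [_ ->] := fd _ tab; exact/df0/subset_itv_oo_cc.
- apply/subspace_continuousP => t tab; exact: has_deriv_in_cvg (fdf _ tab).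
Qed.

(** Stands in for integrating the bound on df from 0 to x, by monotonicity along the segment. *)
Lemma le_pow_of_deriv I f df (A : R) m : 0 \in I -> f 0 = 0 ->
  (forall x, x \in I -> has_deriv_in I f x (df x)) ->
  (forall x, x \in I -> `|df x| <= A * `|x| ^+ m) ->
  forall x, x \in I -> `|f x| <= A / m.+1%:R * `|x| ^+ m.+1.
Proof.
move=> I0 f0 fdf dfA x xI.
pose s := Num.sg (f x).
pose c := A / m.+1%:R * `|x| ^+ m.+1.
pose J : interval R := `[0, 1].
have JI : {homo (fun t => x * t) : t / t \in J >-> t \in I}.
  move=> t; rewrite in_itv /= => t01.
  by have := mem_itv_convex I0 xI t01; rewrite add0r subr0 mulrC.
have s1 : `|s| <= 1 by rewrite normr_sg; case: eqP.
(* The sign s turns f x into |f x|; g has nonpositive derivative on [0, 1] and g 0 = 0, so g 1 = |f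
   x| - c <= 0. *)
pose g t := s * (f \o (fun t => x * t)) t + - c * t ^+ m.+1.
have : g 1 <= g 0.
  apply: (@has_deriv_in_nincr 0 1 g (fun t => s * (df (x * t) * (x * 1)) +
      - c * (m.+1%:R * t ^+ m))); first exact: ler01.
  - move=> t tJ; apply: has_deriv_inD; apply: has_deriv_inZ.
      apply: (has_deriv_in_comp JI); last exact/fdf/JI.
      exact/has_deriv_inZ/has_deriv_in_id.
    exact: has_deriv_in_exp.
  - move=> t tJ; rewrite mulNr subr_le0.
    have t0 : 0 <= t by move: tJ; rewrite in_itv /= => /andP[].
    apply: (le_trans (ler_norm _)); rewrite mulr1 !normrM.
    have -> : c * (m.+1%:R * t ^+ m) = 1 * (A * `|x * t| ^+ m * `|x|).
      rewrite /c normrM (ger0_norm t0) exprMn exprS; field.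
      by rewrite addrC natr1 pnatr_eq0.
    apply: ler_pM => //; rewrite ?mulr_ge0 //.
    by apply: ler_wpM2r => //; exact/dfA/JI.
rewrite /g /= mulr0 f0 mulr0 expr0n /= mulr0 addr0 mulr1 expr1n mulr1.
by rewrite subr_le0 /s -normrEsg.
Qed.

Lemma has_deriv_in_uniq I f x z (a b : R) : x \in I -> z \in I -> x != z ->
  has_deriv_in I f x a -> has_deriv_in I f x b -> a = b.
Proof.
move=> xI zI xz /(has_deriv_in_lim xI zI xz) <-.
by move=> /(has_deriv_in_lim xI zI xz) <-.
Qed.

(** Differentiability at x gives continuity there, so the bound survives the passage to the
    limit. *)
Lemma le_norm_punctured I f x z l (K : R) : x \in I -> z \in I -> x != z ->
  has_deriv_in I f x l ->
  (forall y, y \in I -> y != x -> `|f y| <= K) -> `|f x| <= K.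
Proof.
move=> xI zI xz fl fK; have PF := within_dnbhs_proper xI zI xz.
have fx : f y @[y --> within [set` I] x^'] --> f x.
  move=> A /(has_deriv_in_cvg fl); rewrite /nbhs /= /within /= => nA.
  by apply: filterS nA => y yA _ /yA.
apply: (cvgr_to_le (cvg_norm fx)).
rewrite near_withinE /dnbhs near_withinE.
by near=> y => yx yI; exact: fK.
Unshelve. all: by end_near. Qed.

(** Carrying successive derivatives as data allows polynomials to be subtracted termwise, without
    evaluating [derive_in] again. *)
Definition jet I (u : nat -> R -> R) : Prop :=
  forall n x, x \in I -> has_deriv_in I (u n) x (u n.+1 x).

Lemma smooth_jet I f : smooth_in I f -> jet I (fun n => deriven_in I n f).
Proof. by move=> fI n x xI; exact/derivable_in_has_deriv/fI. Qed.

Lemma jet_sub_poly I (u : nat -> R -> R) p : jet I u ->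
  jet I (fun n x => u n x - p^`(n).[x]).
Proof.
move=> uI n x xI.
have -> : (fun y => u n y - p^`(n).[y]) = (fun y => u n y + (- p^`(n)).[y]).
  by apply/funext => y; rewrite hornerN.
rewrite derivnS -hornerN -derivN; apply: has_deriv_inD; first exact: uI.
exact: has_deriv_in_horner.
Qed.

End Calculus.

(** * Estimates under the substitution of a p-th power *)

Section PowerSubstitution.
Variables (R : realType) (I : interval R) (p : nat).
Hypotheses (p_gt0 : (0 < p)%N) (I0 : 0 \in I) (I1 : 1 \in I).
Hypothesis powI : {homo (fun y : R => y ^+ p) : y / y \in I >-> y \in I}.
Implicit Types (f g : R -> R) (u G : nat -> R -> R) (x y : R) (d i k m n : nat).

Lemma deriv_eq f g x (a b : R) : x \in I -> {in I, f =1 g} ->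
  has_deriv_in I f x a -> has_deriv_in I g x b -> a = b.
Proof.
move=> xI fg /(eq_has_deriv_in xI fg) ga gb.
(* Uniqueness needs a second point of I: 1 if x = 0, and 0 otherwise. *)
have [x0|x0] := eqVneq x 0.
  by apply: (has_deriv_in_uniq xI I1 _ ga gb); rewrite x0 eq_sym oner_neq0.
exact: (has_deriv_in_uniq xI I0 x0 ga gb).
Qed.

Lemma has_deriv_in_comp_pow u i x : jet I u -> x \in I ->
  has_deriv_in I (fun y => u i (y ^+ p)) x (u i.+1 (x ^+ p) * (p%:R * x ^+ p.-1)).
Proof.
move=> uI xI; apply: (has_deriv_in_comp powI); first exact: has_deriv_in_exp.
exact/uI/powI.
Qed.

(** * Order of vanishing at 0 *)

Section Flatness.
Variables (s : nat) (u : nat -> R -> R).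
Hypotheses (u_jet : jet I u) (u0 : forall i, (i < s)%N -> u i 0 = 0).

(* Since u i vanishes at 0 for i < s, it counts as having order s - i there, so
   that [flat d] consists of functions vanishing to order d. *)
Inductive flat : nat -> (R -> R) -> Prop :=
| flat_monomial d (c : R) m i : (d <= m + p * (s - i))%N ->
    flat d (fun y => c * (y ^+ m * u i (y ^+ p)))
| flat_add d g h : flat d g -> flat d h -> flat d (fun y => g y + h y).

Lemma flat_at0 d g : flat d g -> (0 < d)%N -> g 0 = 0.
Proof.
elim=> {d g} [d c [|m] i dmi d0|d g h _ IHg _ IHh d0].
- rewrite [X in u i X]expr0n eqn0Ngt p_gt0 u0 ?mulr0 // -subn_gt0.
  by have := leq_trans d0 dmi; rewrite add0n muln_gt0 => /andP[].
- by rewrite exprS !mul0r mulr0.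
- by rewrite IHg // IHh // addr0.
Qed.

(** In the derivative of y^m u_i(y^p), one term loses a factor y; the other gains y^(p-1) while
    u_(i+1) counts for at most p orders less in y. Either way at most one order is lost. *)
Lemma flat_deriv d g : flat d g -> exists2 dg, flat d.-1 dg &
  forall x, x \in I -> has_deriv_in I g x (dg x).
Proof.
elim=> {d g} [d c m i dmi|d g h _ [dg fg gdg] _ [dh fh hdh]].
- exists (fun y => c * m%:R * (y ^+ m.-1 * u i (y ^+ p)) +
      c * p%:R * (y ^+ (m + p.-1) * u i.+1 (y ^+ p))).
    apply: flat_add; apply: flat_monomial.
      by move: dmi; set q := (p * _)%N; lia.
    (* For s <= i no vanishing is credited to u_i, and the power of y alone carries the order. *)
    have [si|si] := leqP s i.
      by move: dmi; rewrite (eqP si) muln0; lia.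
    by move: dmi; rewrite -(subnSK si) mulnS; set q := (p * _)%N; lia.
  move=> x xI.
  have := has_deriv_inZ c (has_deriv_inM (has_deriv_in_exp I m x)
    (has_deriv_in_comp_pow i u_jet xI)).
  by congr has_deriv_in; rewrite exprD; ring.
- exists (fun y => dg y + dh y); first exact: flat_add.
  by move=> x xI; apply: has_deriv_inD; [exact: gdg|exact: hdh].
Qed.

(** By uniqueness of derivatives G k agrees on I with a function flat of order d - k, which vanishes
    at 0 while k < d. *)
Lemma flat_jet_at0 d g G k : jet I G -> flat d g -> {in I, G 0%N =1 g} ->
  (k < d)%N -> G k 0 = 0.
Proof.
elim: k G d g => [|k IHk] G d g GI fg Gg kd; first by rewrite Gg // (flat_at0 fg).
have [dg fdg gdg] := flat_deriv fg.
apply: (IHk (fun n => G n.+1) _ dg _ fdg) => [n x xI||].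
- exact: GI.
- by move=> x xI; apply: (deriv_eq xI Gg); [exact: GI|exact: gdg].
- by case: d kd {fg fdg}.
Qed.

End Flatness.

(** * Expansion of the Euler operator *)

Lemma ffact_le_expn n k : (n ^_ k <= n ^ k)%N.
Proof.
elim: k => [|k IHk] //.
by rewrite ffactnSr expnSr leq_mul // leq_subr.
Qed.

(* The coefficients of (E/p - (i-1)) ... (E/p - 1) (E/p), E = xi d/dxi, expanded in
   the operators xi^k (d/dxi)^k. *)
Fixpoint euler_coef i k : R :=
  if i is i'.+1 then
    ((k%:R - (p * i')%:R) * euler_coef i' k +
     (if k is k'.+1 then euler_coef i' k' else 0)) / p%:R
  else (k == 0%N)%:R.

Lemma euler_coef_gt i k : (i < k)%N -> euler_coef i k = 0.
Proof.
elim: i k => [|i IHi] [|k] //= ik.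
by rewrite !IHi ?mulr0 ?addr0 ?mul0r // ltnW.
Qed.

(** Induction by applying x d/dx to both sides: the left becomes p i x^(p i) u_i + p x^(p (i+1))
    u_(i+1), and on the right x^k G_k becomes k x^k G_k + x^(k+1) G_(k+1). Solving for the term in
    u_(i+1) is the recursion of [euler_coef]. *)
Lemma euler_expansion u G : jet I u -> jet I G ->
  (forall y, y \in I -> G 0%N y = u 0%N (y ^+ p)) ->
  forall i x, x \in I -> x ^+ (p * i) * u i (x ^+ p) =
    \sum_(k < i.+1) euler_coef i k * (x ^+ k * G k x).
Proof.
move=> uI GI G0; elim=> [|i IHi] x xI.
  by rewrite muln0 big_ord1 /= !mul1r G0.
have p0 : p%:R != 0 :> R by rewrite pnatr_eq0 -lt0n.
have xpred m : x * (m%:R * x ^+ m.-1) = m%:R * x ^+ m.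
  by case: m => [|m]; rewrite ?mul0r ?mulr0 // exprS; ring.
have dL := has_deriv_inM (has_deriv_in_exp I (p * i) x) (has_deriv_in_comp_pow i uI xI).
have dR : has_deriv_in I (fun y => \sum_(k < i.+1) euler_coef i k * (y ^+ k * G k y)) x
    (\sum_(k < i.+1) euler_coef i k * (k%:R * x ^+ k.-1 * G k x + x ^+ k * G k.+1 x)).
  apply: (has_deriv_in_sum (F := fun k y => euler_coef i k * (y ^+ k * G k y))
    (dF := fun k => euler_coef i k * (k%:R * x ^+ k.-1 * G k x + x ^+ k * G k.+1 x))).
  move=> k _; apply/has_deriv_inZ/has_deriv_inM; [exact: has_deriv_in_exp|exact: GI].
have /(congr1 ( *%R x)) := deriv_eq xI IHi dL dR.
rewrite mulrDr mulrA xpred -mulrA (IHi x xI).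
have -> : x * (x ^+ (p * i) * (u i.+1 (x ^+ p) * (p%:R * x ^+ p.-1))) =
    p%:R * (x ^+ (p * i.+1) * u i.+1 (x ^+ p)).
  have xp : x ^+ p = x * x ^+ p.-1 by rewrite -exprS prednK.
  by rewrite mulnS exprD [X in _ = _ * (X * _ * _)]xp; ring.
move/(canRL (addKr _)) => E; apply: (mulfI p0); rewrite {}E.
have coefS k (e : R) : p%:R * (euler_coef i.+1 k * e) =
    (k%:R - (p * i)%:R) * euler_coef i k * e +
    (if k is k'.+1 then euler_coef i k' else 0) * e.
  by rewrite /= mulrA [p%:R * _]mulrC divfK // mulrDl.
rewrite [RHS]mulr_sumr; under [RHS]eq_bigr => k _ do rewrite coefS.
(* The sums are brought to a common range: in the first the coefficient at k = i + 1 is zero, the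
   second has no term at k = 0 and is shifted. *)
rewrite big_split /= [X in _ = X + _]big_ord_recr /= euler_coef_gt //.
rewrite mulr0 mul0r addr0 [X in _ = _ + X]big_ord_recl /= mul0r add0r.
rewrite !mulr_sumr -sumrN -!big_split /=; apply: eq_bigr => k _.
have -> : x * (euler_coef i k * (k%:R * x ^+ k.-1 * G k x + x ^+ k * G k.+1 x)) =
  euler_coef i k * (x * (k%:R * x ^+ k.-1) * G k x + x ^+ k.+1 * G k.+1 x).
  by rewrite exprS; ring.
by rewrite xpred /bump /= add1n; ring.
Qed.

(** With N = p n, each step of the recursion multiplies the weighted sum by at most i + N/p = n + i:
    the factor |k - p i| / p is at most i for k <= i, and shifting k costs one factor N/p. *)
Lemma euler_coef_bound n i :
  \sum_(k < i.+1) `|euler_coef i k| * (p * n)%:R ^+ k <= \prod_(j < i) (n + j)%:R.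
Proof.
elim: i => [|i IHi]; first by rewrite big_ord1 big_ord0 /= normr1 mulr1.
have p0 : 0 < p%:R :> R by rewrite ltr0n.
set N := (p * n)%:R : R; have N0 : 0 <= N by exact: ler0n.
set c' := fun k => if k is k'.+1 then euler_coef i k' else 0.
have coefS k : (k < i.+2)%N -> `|euler_coef i.+1 k| * N ^+ k <=
    i%:R * (`|euler_coef i k| * N ^+ k) + `|c' k| * N ^+ k / p%:R.
  move=> ki; rewrite /= -/(c' k) normrM normfV (gtr0_norm p0).
  have -> : i%:R * (`|euler_coef i k| * N ^+ k) + `|c' k| * N ^+ k / p%:R =
      ((p * i)%:R * `|euler_coef i k| + `|c' k|) / p%:R * N ^+ k.
    by rewrite natrM; field; exact: lt0r_neq0.
  do 2![apply: ler_wpM2r; first by rewrite ?exprn_ge0 ?invr_ge0 // ltW].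
  apply: (le_trans (ler_normD _ _)); rewrite lerD2r normrM.
  have [ik|ki'] := leqP k i; last by rewrite euler_coef_gt // normr0 !mulr0.
  apply: ler_wpM2r => //; rewrite distrC ger0_norm ?lerBlDr ?lerDl //.
  by rewrite subr_ge0 ler_nat (leq_trans ik) // leq_pmull.
apply: (@le_trans _ _ (\sum_(k < i.+2)
    (i%:R * (`|euler_coef i k| * N ^+ k) + `|c' k| * N ^+ k / p%:R))).
  by apply: ler_sum => k _; exact: coefS.
rewrite big_split /= [X in X + _]big_ord_recr /= euler_coef_gt //.
rewrite normr0 mul0r mulr0 addr0 [X in _ + X]big_ord_recl /= normr0 !mul0r add0r.
rewrite [leRHS]big_ord_recr /= -mulr_sumr.
have -> : \sum_(k < i.+1) `|c' (bump 0 k)| * N ^+ bump 0 k / p%:R =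
    n%:R * \sum_(k < i.+1) `|euler_coef i k| * N ^+ k.
  rewrite mulr_sumr; apply: eq_bigr => k _.
  rewrite /bump /= add1n exprS {1}/N natrM; field; exact: lt0r_neq0.
rewrite -mulrDl -natrD mulrC addnC ler_wpM2r //.
Qed.

(** Downward induction from k = N by repeated integration from 0; the divisor m + 1 of each step
    turns N!/m! into N!/(m+1)!. *)
Lemma jet_vanishing_bound G N (B : R) : jet I G ->
  (forall k, (k < N)%N -> G k 0 = 0) ->
  (forall x, x \in I -> `|G N x| <= B * N`!%:R) ->
  forall k x, (k <= N)%N -> x \in I -> `|G k x| <= B * (N ^_ k)%:R * `|x| ^+ (N - k).
Proof.
move=> GI G0 GB k x kN xI.
rewrite -(subKn kN); move: (N - k)%N (leq_subr k N) => m mN {k kN}.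
rewrite subKn //.
elim: m mN x xI => [|m IHm] mN x xI.
  by rewrite subn0 ffactnn expr0 mulr1; exact: GB.
have mN' : (N - m = (N - m.+1).+1)%N by rewrite subnSK.
have NmN : (N - m.+1 < N)%N by rewrite ltn_subrL (leq_trans _ mN).
have dG y : y \in I -> has_deriv_in I (G (N - m.+1)%N) y (G (N - m)%N y).
  by move=> yI; rewrite mN'; exact: GI.
have := le_pow_of_deriv I0 (G0 _ NmN) dG (IHm (ltnW mN)) xI.
move/le_trans; apply; rewrite mN' ffactnSr natrM subKn //.
apply: ler_wpM2r; first exact: exprn_ge0.
by rewrite mulrA mulfK // pnatr_eq0.
Qed.

Lemma power_substitution_bound u G n (B : R) : jet I u -> jet I G ->
  (forall y, y \in I -> G 0%N y = u 0%N (y ^+ p)) ->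
  (forall i, (i < n)%N -> u i 0 = 0) ->
  (forall x, x \in I -> `|G (p * n)%N x| <= B * (p * n)`!%:R) ->
  forall x, x \in I -> x != 0 -> `|u n (x ^+ p)| <= B * \prod_(j < n) (n + j)%:R.
Proof.
move=> uI GI G0 u0 GB x xI x0.
have G_at0 k : (k < p * n)%N -> G k 0 = 0.
  (* As a monomial with m = i = 0, u_0(y^p) has order p (n - 0). *)
  have F : flat n u (p * n) (fun y => 1 * (y ^+ 0 * u 0%N (y ^+ p))).
    by apply: flat_monomial; rewrite add0n subn0.
  move=> kn; apply: (flat_jet_at0 uI u0 GI F _ kn) => y yI.
  by rewrite G0 // expr0 !mul1r.
have Gb := jet_vanishing_bound GI G_at0 GB.
have B0 : 0 <= B.
  by have := le_trans (normr_ge0 _) (GB _ xI); rewrite pmulr_lge0 // ltr0n fact_gt0.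
have xn0 : 0 < `|x| ^+ (p * n) by rewrite exprn_gt0 // normr_gt0.
(* Multiplying by |x|^(p n), nonzero as x is, brings in the Euler expansion; the same power then
   splits off every summand and cancels. *)
rewrite -(ler_pM2l xn0) -normrX -normrM (euler_expansion uI GI G0) //.
apply: (le_trans (ler_norm_sum _ _ _)).
apply: (@le_trans _ _ (\sum_(k < n.+1)
   (`|x| ^+ (p * n) * B) * (`|euler_coef n k| * (p * n)%:R ^+ k))).
  apply: ler_sum => k _; have kpn : (k <= p * n)%N.
    by rewrite (leq_trans _ (leq_pmull n p_gt0)) // -ltnS.
  rewrite !normrM [leRHS]mulrCA; apply: ler_wpM2l => //.
  rewrite normrX; apply: (le_trans (ler_wpM2l _ (Gb _ _ kpn xI))); first exact: exprn_ge0.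
  have -> : `|x| ^+ (p * n) = `|x| ^+ (p * n - k) * `|x| ^+ k.
    by rewrite -exprD subnK.
  have -> : `|x| ^+ k * (B * ((p * n) ^_ k)%:R * `|x| ^+ (p * n - k)) =
    `|x| ^+ (p * n - k) * `|x| ^+ k * B * ((p * n) ^_ k)%:R by ring.
  apply: ler_wpM2l; first by rewrite !mulr_ge0 // exprn_ge0.
  by rewrite -natrX ler_nat ffact_le_expn.
rewrite -mulr_sumr -mulrA normrX; apply: ler_wpM2l; first exact: ltW.
by apply: ler_wpM2l => //; exact: euler_coef_bound.
Qed.


End PowerSubstitution.

(** * Factorial estimates *)

Lemma fact_mul_prod n m : (n`! * \prod_(j < m) (n + j).+1 = (n + m)`!)%N.
Proof.
elim: m => [|m IHm]; first by rewrite big_ord0 muln1 addn0.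
by rewrite big_ord_recr /= mulnA IHm addnS factS mulnC.
Qed.

(** The central binomial coefficient grows by the factor (2n+2)(2n+1)/(n+1)^2 <= 4 at each step. *)
Lemma fact_double_le n : ((n + n)`! <= 4 ^ n * (n`! * n`!))%N.
Proof.
elim: n => [|n IHn] //.
rewrite addnS addSn !factS expnS mulnA.
have -> : (4 * 4 ^ n * (n.+1 * n`! * (n.+1 * n`!)) =
  (n.+1 * n.+1 * 4) * (4 ^ n * (n`! * n`!)))%N by lia.
by apply: leq_mul => //; lia.
Qed.

Lemma prod_le_fact n : (\prod_(j < n) (n + j) <= 4 ^ n * n`!)%N.
Proof.
(* After multiplication by n!, raising each factor by one completes the product to (2n)!. *)
rewrite -(leq_pmul2l (fact_gt0 n)); apply: (@leq_trans (n + n)`!).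
  by rewrite -fact_mul_prod leq_mul // leq_prod.
by rewrite mulnCA fact_double_le.
Qed.

(** * The power map on the interval *)

Lemma mem_power_interval (R : realType) p (x : R) :
  (x \in power_interval R p) = (`|x| <= 1) && (odd p || (0 <= x)).
Proof.
rewrite /power_interval ler_norml; case: (odd p); rewrite in_itv /= ?andbT //.
by apply/idP/idP; lra.
Qed.

Lemma power_interval_exp (R : realType) p (x : R) :
  x \in power_interval R p -> x ^+ p \in power_interval R p.
Proof.
rewrite !mem_power_interval normrX => /andP[x1].
by case: (odd p) => //= x0; rewrite ?exprn_ile1 // exprn_ge0.
Qed.

Lemma power_interval_root (R : realType) p (x : R) : (0 < p)%N ->
  x \in power_interval R p -> exists2 y, y \in power_interval R p & y ^+ p = x.
Proof.
move=> p0; rewrite mem_power_interval => /andP[x1 xp].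
have pK (a : R) : 0 <= a -> (a `^ p%:R^-1) ^+ p = a.
  move=> a0; rewrite -powR_mulrn ?powR_ge0 // -powRrM mulVf ?powRr1 //.
  by rewrite pnatr_eq0 -lt0n.
have r1 : `| `|x| `^ p%:R^-1 | <= 1.
  rewrite ger0_norm ?powR_ge0 // -(@expr_le1 _ p) ?powR_ge0 //.
  by rewrite pK.
have [x0|x0] := leP 0 x.
  exists (`|x| `^ p%:R^-1); last by rewrite pK ?ger0_norm.
  by rewrite mem_power_interval r1 powR_ge0 orbT.
(* A negative point lies in the interval only for odd p, and there the root of |x| changes sign with
   x. *)
move: xp; rewrite leNgt x0 orbF => op.
exists (- (`|x| `^ p%:R^-1)).
  by rewrite mem_power_interval normrN r1 op.
by rewrite exprNn -signr_odd op expr1 pK // mulN1r ltr0_norm // opprK.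
Qed.

(** * Descent from F to f *)

Lemma ultradiff_descend (R : realType) (M : nat -> R) (p : nat) (f : R -> R) :
  (0 < p)%N -> smooth_in (power_interval R p) f ->
  ultradiff (power_interval R p) M (fun xi : R => f (xi ^+ p)) ->
  ultradiff (power_interval R p) (dilate p M) f.
Proof.
move=> p0; set I := power_interval R p; set F := fun xi : R => f (xi ^+ p).
move=> fI [FI [C [r [C0 r0 Fb]]]]; split=> //.
have I0 : 0 \in I by rewrite mem_power_interval normr0 ler01 lexx orbT.
have I1 : 1 \in I by rewrite mem_power_interval normr1 lexx ler01 orbT.
have n01 : (0 : R) != 1 by rewrite eq_sym oner_neq0.
(* The factor r^p comes from differentiating F to order p n, and 4 from the bound 4^n n! on the
   product. *)
exists C, (4 * r ^+ p); split=> //; first by rewrite mulr_gt0 // exprn_gt0.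
move=> n.
suff bound x : x \in I -> x != 0 ->
    `|deriven_in I n f x| <= C * (4 * r ^+ p) ^+ n * weighted (dilate p M) n.
  move=> x xI; have [->|] := eqVneq x 0; last exact: bound.
  exact: (le_norm_punctured I0 I1 n01 (smooth_jet fI n I0) bound).
move=> xI x0; have [y yI yx] := power_interval_root p0 xI.
have y0 : y != 0 by apply: contraNneq x0 => y0; rewrite -yx y0 expr0n eqn0Ngt p0.
pose T := \poly_(j < n) (deriven_in I j f 0 / j`!%:R).
have sT : (size T <= n)%N by exact: size_poly.
(* T(xi^p) has degree less than p n, so subtracting it from F leaves the derivative of order p n
   unchanged. *)
have sTp : (size (T \Po 'X^p) <= p * n)%N.
  have [T0|Tn0] := eqVneq T 0; first by rewrite T0 comp_poly0 size_poly0.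
  have := size_comp_poly T 'X^p; rewrite size_polyXn /=.
  have : ((size T).-1 * p + p <= p * n)%N.
    by rewrite -mulSnr prednK ?size_poly_gt0 // mulnC leq_mul2l sT orbT.
  move=> Tn sE; rewrite (leq_trans (leqSpred _)) // sE (leq_trans _ Tn) //.
  by rewrite -addn1 leq_add2l.
pose u i z := deriven_in I i f z - T^`(i).[z].
pose G i z := deriven_in I i F z - (T \Po 'X^p)^`(i).[z].
have -> : deriven_in I n f x = u n (y ^+ p).
  by rewrite /u derivn_poly0 // horner0 subr0 yx.
have Gb z : z \in I -> `|G (p * n)%N z| <= C * r ^+ (p * n) * M (p * n)%N * (p * n)`!%:R.
  by move=> zI; rewrite /G derivn_poly0 // horner0 subr0 mulrAC -mulrA; exact: Fb.
have G0 z : z \in I -> G 0%N z = u 0%N (z ^+ p).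
  by rewrite /G /u !derivn0 horner_comp hornerXn.
have u0 i : (i < n)%N -> u i 0 = 0.
  move=> ilt; rewrite /u horner_coef0 coef_derivn addn0 coef_poly ilt ffactnn /=.
  by rewrite -[_ / _ *+ _]mulr_natr divfK ?subrr // pnatr_eq0 -lt0n fact_gt0.
have := power_substitution_bound p0 I0 I1 (@power_interval_exp R p)
  (jet_sub_poly T (smooth_jet fI)) (jet_sub_poly (T \Po 'X^p) (smooth_jet FI)) G0 u0 Gb yI y0.
move/le_trans; apply.
(* The sign is read off at 0, where this quantity times (p n)! bounds an absolute value. *)
have M0 : 0 <= C * r ^+ (p * n) * M (p * n)%N.
  have := le_trans (normr_ge0 _) (Gb _ I0).
  by rewrite pmulr_lge0 // ltr0n fact_gt0.
have -> : C * (4 * r ^+ p) ^+ n * weighted (dilate p M) n =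
    C * r ^+ (p * n) * M (p * n)%N * (4 ^ n * n`!)%:R.
  by rewrite /weighted /dilate exprMn -exprM natrM natrX; ring.
by apply: ler_wpM2l => //; rewrite -natr_prod ler_nat prod_le_fact.
Qed.

(** * Comparison of the two weights *)

Lemma fact_mul_ge p n : (0 < p)%N -> (n ^ ((p - 1) * n) * n`! <= (p * n)`!)%N.
Proof.
case: p => // p _; rewrite subSS subn0 mulSn -fact_mul_prod mulnC leq_mul //.
(* The quotient of the two factorials is a product of factors [(n + j).+1], one for each j below the
   exponent, each at least n. *)
rewrite -[X in (n ^ X)%N]card_ord -prod_nat_const; apply: leq_prod => j _.
by rewrite (leq_trans (leq_addr j n)).
Qed.

Lemma fact_mul_le p n : (0 < p)%N -> ((p * n)`! <= (p * n) ^ ((p - 1) * n) * n`!)%N.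
Proof.
case: p => // p _; rewrite subSS subn0 {1}mulSn -fact_mul_prod mulnC leq_mul //.
(* With j below the exponent, [(n + j).+1] is at most the base. *)
rewrite -[X in (_ ^ X)%N]card_ord -prod_nat_const; apply: leq_prod => j _.
by rewrite -addnS mulSn leq_add2l.
Qed.

Theorem theorem2p1 (R : realType) (M : nat -> R) (p : nat) (f : R -> R)
    (M_incr : forall n : nat, M n <= M n.+1)
    (M0 : M 0%N = 1)
    (p_gt1 : (1 < p)%N)
    (f_smooth : smooth_in (power_interval R p) f) :
  (ultradiff (power_interval R p) M (fun xi : R => f (xi ^+ p)) ->
   ultradiff (power_interval R p) (dilate p M) f)
  /\
  (ultradiff (power_interval R p) (dilate p M) f <->
   deriv_bounded (power_interval R p) (dilate_weight p (weighted M)) f).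
Proof.
have p_gt0 := ltnW p_gt1.
have M_ge0 n : 0 <= M n.
  by elim: n => [|n IHn]; [rewrite M0|exact: le_trans (M_incr n)].
(* At n = 0 the exponent is 0, so the power is 1 despite the base 0. *)
have nX n : 0 < n%:R ^+ ((p - 1) * n) :> R.
  by case: n => [|n]; [rewrite muln0 expr0|rewrite exprn_gt0 // ltr0n].
split; first exact: ultradiff_descend.
rewrite /ultradiff /deriv_bounded /dilate_weight /weighted /dilate.
split=> [[_ [C [r [C0 r0 fb]]]]|[C [r [C0 r0 fb]]]].
  exists C, r; split=> // n x xI; apply: (le_trans (fb n x xI)).
  apply: ler_wpM2l; first by rewrite mulr_ge0 ?exprn_ge0 // ltW.
  rewrite mulrA ler_wpM2r // mulrC ler_pdivlMr // mulrC -natrX -natrM ler_nat.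
  exact: fact_mul_ge.
(* Since (p n)^((p-1) n) = p^((p-1) n) n^((p-1) n), the first factor is absorbed into the n-th power
   of the new radius. *)
split=> //; exists C, (p%:R ^+ (p - 1) * r); split=> //.
  by rewrite mulr_gt0 // exprn_gt0 // ltr0n.
move=> n x xI; apply: (le_trans (fb n x xI)).
have -> : C * (p%:R ^+ (p - 1) * r) ^+ n * (n`!%:R * M (p * n)%N) =
    C * r ^+ n * (p%:R ^+ ((p - 1) * n) * n`!%:R * M (p * n)%N).
  by rewrite exprMn exprM; ring.
apply: ler_wpM2l; first by rewrite mulr_ge0 ?exprn_ge0 // ltW.
rewrite mulrA ler_wpM2r // mulrC ler_pdivrMr //.
have := fact_mul_le n p_gt0; rewrite -(ler_nat R) natrM natrX natrM exprMn.
by move/le_trans; apply; rewrite le_eqVlt; apply/orP; left; apply/eqP; ring.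
Qed.
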